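(* Let $r\in(0,1)$, let $g_0\in SO(3)$ be an initial configuration and let $\mathbf X_f\in S^2$ be a final location for which an $LG$ path from $g_0$ to $\mathbf X_f$ exists. Let $(\phi_1^{s1},\phi_2^{s1})$ and $(\phi_1^{s2},\phi_2^{s2})$ be the arc angles of the first and the second $LG$ path, respectively, as defined in the context. Then the length of the second $LG$ path is greater than or equal to the length of the first $LG$ path, i.e. $$r\phi_1^{s1}+\phi_2^{s1}\le r\phi_1^{s2}+\phi_2^{s2}.$$ Moreover, the arc angle of the $G$ segment of the first $LG$ path satisfies $\phi_2^{s1}\in[0,\pi]$.
   Context: Dubins vehicle on the unit sphere. Fix $r\in(0,1)$ and put $U_{max}=\frac{\sqrt{1-r^2}}{r}$. A configuration is a rotation matrix $g=(\mathbf X\ \ \mathbf T\ \ \mathbf N)\in SO(3)$ with columns $\mathbf X$ (location on the unit sphere), $\mathbf T$ (heading) and $\mathbf N=\mathbf X\times\mathbf T$, evolving with arc length $s$ by $$\mathbf X'=\mathbf T,\qquad \mathbf T'=-\mathbf X+u_g\mathbf N,\qquad \mathbf N'=-u_g\mathbf T,\qquad u_g\in[-U_{max},U_{max}].$$ An $L$ segment has $u_g\equiv U_{max}$ (length $r\phi$ for arc angle $\phi$); a $G$ segment has $u_g\equiv 0$ (great-circle arc, length $\phi$ for arc angle $\phi$). An $LG$ path from $g_0$ to $\mathbf X_f$ is an $L$ segment of arc angle $\phi_1\in[0,2\pi)$ followed by a $G$ segment of arc angle $\phi_2\in[0,2\pi)$, starting at configuration $g_0$ and ending at location $\mathbf X_f$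 (terminal orientation free). Its length is $r\phi_1+\phi_2$. Let $(\beta_1,\beta_2,\beta_3)^T=g_0^T\mathbf X_f$ be the coordinates of $\mathbf X_f$ in the initial frame (the coordinates of $\mathbf X_f$ itself if $g_0$ is the identity). Put $$D=\Big(\big((1-r^2)\beta_3-r\sqrt{1-r^2}\,\beta_1\big)^2+(1-r^2)\beta_2^2\Big)^{1/2}$$ (when an $LG$ path exists, $D\ne0$), let $\gamma$ be the angle in $(-\pi,\pi]$ with $$\cos\gamma=\frac{(1-r^2)\beta_3-r\sqrt{1-r^2}\,\beta_1}{D},\qquad \sin\gamma=\frac{\sqrt{1-r^2}\,\beta_2}{D},$$ and $$\delta=\frac{-r^2\beta_3-r\sqrt{1-r^2}\,\beta_1}{D}$$ (when an $LG$ path exists, $\delta\in[-1,1]$). The $L$ arc angles of the first and second $LG$ paths are $$\phi_1^{s1}=\big(\cos^{-1}(\delta)-\gamma\big)\bmod 2\pi,\qquad \phi_1^{s2}=\big(2\pi-\cos^{-1}(\delta)-\gamma\big)\bmod 2\pi,$$ both in $[0,2\pi)$, with $\cos^{-1}$ valued in $[0,\pi]$. For $i\in\{1,2\}$, $\phi_2^{si}\in[0,2\pi)$ is the unique angle with, for $\phi_1=\phi_1^{si}$ and $\phi_2=\phi_2^{si}$, $$\cos\phi_2=\big(1-(1-\cos\phi_1)r^2\big)\beta_1+r\sin\phi_1\,\beta_2+(1-\cos\phi_1)\,r\sqrt{1-r^2}\,\beta_3,$$ $$\sin\phi_2=-r\sin\phi_1\,\beta_1+\cos\phi_1\,\beta_2+\sin\phi_1\sqrt{1-r^2}\,\beta_3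 .$$ (The two $LG$ paths may coincide.) *)

(* Defs.v *)
From HB Require Import structures.
From mathcomp Require Import all_boot all_order all_algebra.
From mathcomp Require Import all_classical all_reals all_analysis.
Set Implicit Arguments.
Unset Strict Implicit.
Unset Printing Implicit Defensive.
Import Order.TTheory GRing.Theory Num.Theory.
Import numFieldNormedType.Exports.
Local Open Scope classical_set_scope.
Local Open Scope ring_scope.

Section DubinsSphere.
Context {R : realType}.

(* The library norm on matrices is the sup norm, hence the explicit sum. *)
Definition on_sphere (x : 'cV[R]_3) : Prop := \sum_(i < 3) x i 0 ^+ 2 = 1.

(* The condition N = X x T on the columns is det g = 1. *)
Definition SO3 (g : 'M[R]_3) : Prop := g^T *m g = 1%:M /\ \det g = 1.

Definition locX (g : 'M[R]_3) : 'cV[R]_3 := col 0 g.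
Definition headT (g : 'M[R]_3) : 'cV[R]_3 := col 1 g.
Definition normalN (g : 'M[R]_3) : 'cV[R]_3 := col 2 g.

Definition Umax (r : R) : R := Num.sqrt (1 - r ^+ 2) / r.

(* Trajectory of the vehicle on the arc-length interval [a, b] under the
   constant control u.  The equations are imposed in the interior, and g is
   continuous up to the end points, where u may jump. *)
Definition segment (u : R) (g : R -> 'M[R]_3) (a b : R) : Prop :=
  [/\ {within `[a, b], continuous g},
      (forall s, a <= s <= b -> SO3 (g s)) &
      (forall s, a < s < b ->
        [/\ is_derive s 1 (fun t => locX (g t)) (headT (g s)),
            is_derive s 1 (fun t => headT (g t))
              (- locX (g s) + u *: normalN (g s)) &
            is_derive s 1 (fun t => normalN (g t)) (- u *: headT (g s))])].

Definition LG_path (r : R) (g0 : 'M[R]_3) (Xf : 'cV[R]_3) (phi1 phi2 : R)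
    (g : R -> 'M[R]_3) : Prop :=
  [/\ 0 <= phi1 < 2 * pi, 0 <= phi2 < 2 * pi, g 0 = g0,
      segment (Umax r) g 0 (r * phi1) /\
      segment 0 g (r * phi1) (r * phi1 + phi2) &
      locX (g (r * phi1 + phi2)) = Xf].

Definition LG_path_exists (r : R) (g0 : 'M[R]_3) (Xf : 'cV[R]_3) : Prop :=
  exists phi1 phi2 g, LG_path r g0 Xf phi1 phi2 g.

Definition LG_length (r phi1 phi2 : R) : R := r * phi1 + phi2.

Definition local_coords (g0 : 'M[R]_3) (Xf : 'cV[R]_3) : 'cV[R]_3 :=
  g0^T *m Xf.

Definition mod2pi (x : R) : R :=
  x - (Num.floor (x / (2 * pi)))%:~R * (2 * pi).

Section Angles.
Variables (r : R) (beta : 'cV[R]_3).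
Let b1 := beta 0 0.
Let b2 := beta 1 0.
Let b3 := beta 2 0.

Definition LG_D : R :=
  Num.sqrt (((1 - r ^+ 2) * b3 - r * Num.sqrt (1 - r ^+ 2) * b1) ^+ 2
            + (1 - r ^+ 2) * b2 ^+ 2).

(* [get] is definite description here: at most one angle satisfies the
   conditions, and there is one as soon as LG_D is nonzero. *)
Definition LG_gamma : R :=
  get [set gamma : R |
    [/\ - pi < gamma <= pi,
        cos gamma =
          ((1 - r ^+ 2) * b3 - r * Num.sqrt (1 - r ^+ 2) * b1) / LG_D &
        sin gamma = Num.sqrt (1 - r ^+ 2) * b2 / LG_D]].

Definition LG_delta : R :=
  (- (r ^+ 2) * b3 - r * Num.sqrt (1 - r ^+ 2) * b1) / LG_D.

Definition phi1_s1 : R := mod2pi (acos LG_delta - LG_gamma).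
Definition phi1_s2 : R := mod2pi (2 * pi - acos LG_delta - LG_gamma).

Definition G_angle (phi1 : R) : R :=
  get [set phi2 : R |
    [/\ 0 <= phi2 < 2 * pi,
        cos phi2 = (1 - (1 - cos phi1) * r ^+ 2) * b1 + r * sin phi1 * b2
                   + (1 - cos phi1) * r * Num.sqrt (1 - r ^+ 2) * b3 &
        sin phi2 = - (r * sin phi1) * b1 + cos phi1 * b2
                   + sin phi1 * Num.sqrt (1 - r ^+ 2) * b3]].

Definition phi2_s1 : R := G_angle phi1_s1.
Definition phi2_s2 : R := G_angle phi1_s2.

End Angles.
End DubinsSphere.

(* Main.v *)
(** Write c = sqrt (1 - r^2) and h = c b1 + r b3.  The rotation axis rN + cX is
constant along the L segment, and N along the G segment; as the end point is
orthogonal to N, h = c <Xf, X> with X the junction point, so |h| <= c.  This is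
all that is needed of the path, and it gives D > 0 and |delta| <= 1.

Both LG paths satisfy c cos phi2 = h and c sin phi2 = D sin (phi1 + gamma), so
phi2 is f in [0, pi] for the first path and 2 pi - f for the second (unless the
paths coincide).  With a = acos delta, the L angle of the first path exceeds
that of the second by at most 2 a, hence it suffices that r a <= pi - f.  This
follows from r tan a = tan (pi - f) by convexity of the tangent. *)
Require Import Defs.
From mathcomp Require Import all_boot all_order all_algebra.
From mathcomp Require Import all_classical all_reals all_analysis.
From mathcomp Require Import ring lra.
Set Implicit Arguments.
Unset Strict Implicit.
Unset Printing Implicit Defensive.
Import Order.TTheory GRing.Theory Num.Theory.
Import numFieldNormedType.Exports.
Local Open Scope classical_set_scope.
Local Open Scope ring_scope.

(** * Angles on the circle, reduction modulo 2 pi and a sine inequality *)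

Section Trig.
Context {R : realType}.
Implicit Types x y a b k r phi : R.

Lemma sin_le0_le0 x : - pi < x < pi -> sin x <= 0 -> x <= 0.
Proof.
move=> /andP[_ xpi] sx; rewrite leNgt; apply/negP => x0.
by have := @sin_gt0_pi R x; rewrite x0 xpi => /(_ isT); rewrite ltNge sx.
Qed.

(** The range is that of [LG_gamma]: this gives the existence that [get] requires. *)
Lemma unit_circle_angle_pi x y : x ^+ 2 + y ^+ 2 = 1 ->
  exists a, [/\ - pi < a <= pi, cos a = x & sin a = y].
Proof.
move=> xy.
have x1 : -1 <= x <= 1 by have := sqr_ge0 y; nra.
have sE : sin (acos x) = `|y|.
  by rewrite sin_acos // -sqrtr_sqr; congr Num.sqrt; rewrite -xy; ring.
have cE : cos (acos x) = x by apply: acosK; rewrite in_itv.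
have a0 := acos_ge0 x1; have a1 := acos_lepi x1; have p0 : 0 < (pi : R) := pi_gt0 R.
have [y0|y0] := leP 0 y.
  exists (acos x); split=> //; last by rewrite sE ger0_norm.
  by rewrite a1 andbT; lra.
exists (- acos x); split; rewrite ?cosN ?sinN ?sE ?ltr0_norm ?opprK //.
(* The range excludes [- pi], so [acos x = pi] must be ruled out when [y < 0]. *)
have : acos x != pi.
  apply: contraTneq y0 => ap; rewrite -leNgt.
  by have := sE; rewrite ap sinpi => /esym/normr0_eq0 ->.
move=> h; have : acos x < pi by rewrite lt_neqAle h a1.
by move=> ?; apply/andP; split; lra.
Qed.

Lemma unit_circle_angle_2pi x y : x ^+ 2 + y ^+ 2 = 1 ->
  exists a, [/\ 0 <= a < 2 * pi, cos a = x & sin a = y].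
Proof.
move=> /unit_circle_angle_pi [a [/andP[a1 a2] ca sa]].
have p0 : 0 < (pi : R) := pi_gt0 R.
have [a0|a0] := leP 0 a.
  by exists a; split=> //; apply/andP; split; lra.
have E : a + 2 * pi = a + pi *+ 2 by rewrite mulr_natl.
exists (a + 2 * pi); split; rewrite ?E ?cosD2pi ?sinD2pi // -E; apply/andP; split; lra.
Qed.

Lemma sinDz2pi x (k : int) : sin (x + k%:~R * (2 * pi)) = sin x.
Proof.
have H y (n : nat) : sin (y + n%:R * (2 * pi)) = sin y.
  by rewrite !mulr_natl (periodicn (@sinD2pi R)).
case: k => n; first exact: H.
by rewrite -[LHS](H _ n.+1) NegzE mulrNz mulNr subrK.
Qed.

Lemma cosDz2pi x (k : int) : cos (x + k%:~R * (2 * pi)) = cos x.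
Proof. by rewrite -!sinDpihalf addrAC sinDz2pi. Qed.

Lemma mod2piDz x (k : int) : mod2pi (x + k%:~R * (2 * pi)) = mod2pi x.
Proof.
have p0 : 2 * pi != 0 :> R by rewrite gt_eqF // mulr_gt0 ?pi_gt0.
rewrite /mod2pi; move: (2 * pi) p0 => T p0; rewrite mulrDl mulfK // floorDrz ?intr_int // intrD (floorK (intr_int R k)); ring.
Qed.

(** The floor is monotone: passing a multiple of 2 pi on the way only lowers the left side. *)
Lemma mod2piD_le x y : 0 <= y -> mod2pi (x + y) <= mod2pi x + y.
Proof.
move=> y0; have p0 : 0 < 2 * pi :> R by rewrite mulr_gt0 ?pi_gt0.
rewrite /mod2pi [leRHS]addrAC lerD2l lerN2 ler_pM2r // ler_int.
by apply: le_floor; rewrite ler_pM2r ?invr_gt0 // lerDl.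
Qed.

(* That is, tan (r a) <= r tan a, in a form valid beyond pi / 2. *)
Lemma sin_scale_le r a : 0 <= r <= 1 -> 0 <= a <= pi ->
  cos a * sin (r * a) <= r * (sin a * cos (r * a)).
Proof.
move=> /andP[r0 r1] /andP[a0 a1].
(* [f] vanishes at 0 and its derivative is nonnegative on [0, pi]. *)
pose f x := r * (sin x * cos (r * x)) - cos x * sin (r * x).
have df x : is_derive x 1 f ((1 - r ^+ 2) * (sin x * sin (r * x))).
  rewrite /f.
  apply: is_derive_eq.
  rewrite /GRing.scale /=.
  ring.
have fc : {within `[0, pi], continuous f}%classic.
  apply: continuous_subspaceT => x.
  by apply: differentiable_continuous; apply/derivable1_diffP; apply: ex_derive.
have := @ger0_derive1_ndecr R f 0 pi.
move=> /(_ _ _ fc 0 a (lexx _) a0 a1).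
rewrite /f !mulr0 !sin0 mul0r !mulr0 subr0 subr_ge0; apply.
  by move=> x _; apply: ex_derive.
move=> x; rewrite in_itv /= => /andP[x0 x1]; rewrite derive1E (@derive_val _ _ _ _ _ _ _ (df x)).
apply: mulr_ge0; first by nra.
by apply: mulr_ge0; apply: sin_ge0_pi; apply/andP; split; nra.
Qed.

End Trig.

(** * The conserved axis and the bound on h *)

Lemma is_derive_coord (R : realType) (m n : nat) (M : R -> 'M[R]_(m, n))
    (dM : 'M[R]_(m, n)) (t : R) (i : 'I_m) (j : 'I_n) :
  is_derive t 1 M dM -> is_derive t 1 (fun s => M s i j) (dM i j).
Proof.
move=> [dM1 dM2]; apply: DeriveDef; first by move/derivable_mxP: dM1; apply.
by rewrite -dM2 derive_mx // mxE.
Qed.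

(* N + u X is, up to scale, the rotation axis of a segment of curvature u. *)
Lemma segment_axis (R : realType) (u : R) (g : R -> 'M[R]_3) (a b : R) :
  a <= b -> segment u g a b ->
  normalN (g b) + u *: locX (g b) = normalN (g a) + u *: locX (g a).
Proof.
move=> ab [gc _ gd]; apply/matrixP => i j; rewrite !ord1 {j}.
pose f s := (normalN (g s) + u *: locX (g s)) i 0.
suff : f b - f a = 0 by move/eqP; rewrite subr_eq0 => /eqP.
have fE s : f s = g s i 2%:R + u * g s i 0 by rewrite /f !mxE.
have [||c _ ->] := @MVT_segment R f (fun=> 0) a b ab; last by rewrite mul0r.
- move=> s; rewrite in_itv /= => /gd [dX _ dN].
  have := is_deriveD dN (is_deriveZ u dX).
  by rewrite scaleNr addNr => /(is_derive_coord i 0); rewrite mxE.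
(* The equations hold only in the interior; continuity at the end points comes from that of [g]. *)
- rewrite (funext fE) => x.
  have gij k : (fun s => g s i k : R) @ (x : subspace `[a, b]) --> g x i k.
    apply: (@continuous_comp (subspace `[a, b]) _ _ g (fun M : 'M[R]_3 => M i k)).
      exact: gc.
    exact: coord_continuous.
  exact: cvgD (gij _) (cvgM (cvg_cst _) (gij _)).
Qed.

Lemma SO3_dot_col (R : realType) (g : 'M[R]_3) (i j : 'I_3) :
  SO3 g -> \sum_(k < 3) g k i * g k j = (i == j)%:R.
Proof.
case=> /matrixP/(_ i j) + _; rewrite !mxE => <-.
by apply: eq_bigr => k _; rewrite !mxE.
Qed.

Lemma local_coords_norm (R : realType) (g : 'M[R]_3) (x : 'cV[R]_3) :
  SO3 g -> on_sphere x -> on_sphere (local_coords g x).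
Proof.
have nE (y : 'cV[R]_3) : \sum_(i < 3) y i 0 ^+ 2 = (y^T *m y) 0 0.
  by rewrite mxE; apply: eq_bigr => i _; rewrite !mxE expr2.
case=> /mulmx1C gg _; rewrite /on_sphere !nE /local_coords trmx_mul trmxK.
by rewrite -mulmxA (mulmxA g) gg mul1mx.
Qed.

(** For unit vectors, 2 + 2 <x, y> and 2 - 2 <x, y> are the squared lengths of x + y and x - y. *)
Lemma cauchy_schwarz_sphere (R : realType) (x y : 'cV[R]_3) :
  on_sphere x -> on_sphere y -> `|\sum_(i < 3) x i 0 * y i 0| <= 1.
Proof.
rewrite /on_sphere !big_ord_recl !big_ord0 => hx hy.
rewrite ler_norml; apply/andP; split.
- have := sqr_ge0 (x ord0 0 + y ord0 0); have := sqr_ge0 (x (lift ord0 ord0) 0 + y (lift ord0 ord0) 0).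
  have := sqr_ge0 (x (lift ord0 (lift ord0 ord0)) 0 + y (lift ord0 (lift ord0 ord0)) 0).
  lra.
- have := sqr_ge0 (x ord0 0 - y ord0 0); have := sqr_ge0 (x (lift ord0 ord0) 0 - y (lift ord0 ord0) 0).
  have := sqr_ge0 (x (lift ord0 (lift ord0 ord0)) 0 - y (lift ord0 (lift ord0 ord0)) 0).
  lra.
Qed.

Lemma SO3_on_sphere (R : realType) (g : 'M[R]_3) : SO3 g -> on_sphere (locX g).
Proof.
move=> /(SO3_dot_col 0 0); rewrite eqxx /= /on_sphere mulr1n => <-.
by apply: eq_bigr => k _; rewrite !mxE expr2.
Qed.

Lemma LG_path_axis_bound (R : realType) (r : R) (g0 : 'M[R]_3) (Xf : 'cV[R]_3) :
  0 < r < 1 -> LG_path_exists r g0 Xf ->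
  `|Num.sqrt (1 - r ^+ 2) * local_coords g0 Xf 0 0 + r * local_coords g0 Xf 2 0|
  <= Num.sqrt (1 - r ^+ 2).
Proof.
move=> /andP[r0 r1] [p1 [p2 [g []]]] /andP[p10 _] /andP[p20 _] gE [sL sG] gX.
set c := Num.sqrt _; set b := local_coords _ _.
have lp1 : 0 <= r * p1 by rewrite mulr_ge0 // ltW.
have lp2 : r * p1 <= r * p1 + p2 by rewrite lerDl.
have axL := segment_axis lp1 sL.
have axG := segment_axis lp2 sG.
have so1 : SO3 (g (r * p1)) by case: sL => _ + _; apply; rewrite lp1 lexx.
have so2 : SO3 (g (r * p1 + p2)) by case: sG => _ + _; apply; rewrite lp2 lexx.
have -> : c * b 0 0 + r * b 2 0 =
    c * \sum_(i < 3) locX (g (r * p1 + p2)) i 0 * locX (g (r * p1)) i 0.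
  rewrite !scale0r !addr0 in axG.
  (* The two conservation laws in one, multiplied by [r] because [Umax r] is c / r. *)
  have w k : r * g0 k 2 + c * g0 k 0 =
             r * g (r * p1 + p2) k 2 + c * g (r * p1) k 0.
    have e y : r * (c / r * y) = c * y by field; rewrite gt_eqF.
    move/matrixP/(_ k 0) : axL; move/matrixP/(_ k 0): axG; rewrite gE !mxE => -> h.
    by have := congr1 ( *%R r) h; rewrite !mulrDr !e.
  (* Location and normal at the end point are orthogonal, so pairing [w] with the location removes
     the normal. *)
  have o := SO3_dot_col 0 2 so2.
  rewrite /b /local_coords !mxE !mulr_sumr -big_split /= -[RHS]addr0.
  rewrite -[X in _ = _ + X](mulr0 r) -[X in _ = _ + r * X]o mulr_sumr -big_split /=.
  apply: eq_bigr => k _; rewrite -gX !mxE.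
  transitivity ((r * g0 k 2 + c * g0 k 0) * g (r * p1 + p2) k 0); first by ring.
  by rewrite w; ring.
have c0 : 0 <= c by exact: sqrtr_ge0.
rewrite normrM (ger0_norm c0) ler_piMr //.
by apply: cauchy_schwarz_sphere; exact: SO3_on_sphere.
Qed.

(** * The angle formulas in terms of h and the comparison of lengths *)

Section Angles.
Context {R : realType}.
Variables (r : R) (b : 'cV[R]_3).
Local Notation c := (Num.sqrt (1 - r ^+ 2)).
Local Notation h := (c * b 0 0 + r * b 2 0).
Local Notation D := (LG_D r b).
Local Notation gamma := (LG_gamma r b).
Local Notation delta := (LG_delta r b).
Hypothesis r01 : 0 < r < 1.
Hypothesis b_sphere : on_sphere b.
Hypothesis h_le : `|h| <= c.

Let c2 : c ^+ 2 = 1 - r ^+ 2.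
Proof. by rewrite sqr_sqrtr //; case/andP: r01; nra. Qed.

Let c_gt0 : 0 < c.
Proof. by rewrite sqrtr_gt0; case/andP: r01; nra. Qed.

Let b_norm : b 0 0 ^+ 2 + b 1 0 ^+ 2 + b 2 0 ^+ 2 = 1.
Proof.
move: b_sphere; rewrite /on_sphere !big_ord_recl big_ord0 addr0 addrA.
by congr (_ ^+ 2 + b _ _ ^+ 2 + b _ _ ^+ 2 = _); apply/val_inj.
Qed.

Let b1_sqr : b 1 0 ^+ 2 = 1 - b 0 0 ^+ 2 - b 2 0 ^+ 2.
Proof. by rewrite -b_norm; ring. Qed.

Let h2_le : h ^+ 2 <= c ^+ 2.
Proof. by rewrite -(real_normK (num_real h)) lerXn2r ?nnegrE ?sqrtr_ge0. Qed.

(** [h] is the coordinate of the point [b] along the unit axis (c, 0, r), and D / c is the distance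
    of [b] from that axis. *)
Lemma LG_D_sqr : D ^+ 2 = c ^+ 2 * (1 - h ^+ 2).
Proof.
rewrite [LHS]sqr_sqrtr; first by ring: c2 b1_sqr.
by rewrite addr_ge0 ?sqr_ge0 // mulr_ge0 ?sqr_ge0 // -c2 sqr_ge0.
Qed.

Lemma LG_D_gt0 : 0 < D.
Proof.
rewrite lt_neqAle sqrtr_ge0 andbT eq_sym -sqrf_eq0 LG_D_sqr gt_eqF //.
rewrite mulr_gt0 ?exprn_gt0 // subr_gt0 (le_lt_trans h2_le) // c2.
by case/andP: r01 => r0 r1; rewrite ltrBlDr ltrDl exprn_gt0.
Qed.

Lemma LG_D_delta : D * delta = - (r * h).
Proof. by rewrite mulrC divfK ?gt_eqF ?LG_D_gt0 //; ring. Qed.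

(** Squared and multiplied by D^2, the bound reads r^2 h^2 <= c^2 - h^2 + r^2 h^2, which is
    [h2_le]. *)
Lemma LG_delta_itv : -1 <= delta <= 1.
Proof.
rewrite -ler_norml -(@ler_pXn2r _ 2) ?nnegrE // expr1n real_normK ?num_real //.
rewrite -(@ler_pM2l _ (D ^+ 2)) ?exprn_gt0 ?LG_D_gt0 // mulr1 -exprMn LG_D_delta.
rewrite LG_D_sqr sqrrN exprMn.
have -> : c ^+ 2 * (1 - h ^+ 2) = c ^+ 2 - h ^+ 2 + r ^+ 2 * h ^+ 2 by ring: c2.
by rewrite lerDr subr_ge0.
Qed.

(** D^2 is the sum of the squares of the two numerators in [LG_gamma], so the prescribed values lie
    on the unit circle and [get] has a witness. *)
Lemma LG_gammaP :
  D * cos gamma = c * (c * b 2 0 - r * b 0 0) /\ D * sin gamma = c * b 1 0.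
Proof.
have D0 := LG_D_gt0; have Dn0 : D != 0 by rewrite gt_eqF.
pose x := (1 - r ^+ 2) * b 2 0 - r * c * b 0 0.
have D2 : D ^+ 2 = x ^+ 2 + (1 - r ^+ 2) * b 1 0 ^+ 2.
  by apply: sqr_sqrtr; rewrite addr_ge0 ?sqr_ge0 // mulr_ge0 ?sqr_ge0 // -c2 sqr_ge0.
have [|g gP] := @unit_circle_angle_pi R (x / D) (c * b 1 0 / D).
  by rewrite !expr_div_n -mulrDl exprMn c2 -D2 divff // expf_neq0.
rewrite /LG_gamma; set P := (X in get X).
have [_ -> ->] := getPex (ex_intro P g gP).
by rewrite /x; split; field: c2.
Qed.

(** In the proof, [x] and [y] are the coordinates of the end point along location and heading after
    an L arc of angle [phi]. The hypothesis says that its coordinate along the normal is zero, so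
    x^2 + y^2 = 1 and the angle exists. *)
Lemma G_angleP phi : cos (phi + gamma) = delta ->
  [/\ 0 <= G_angle r b phi < 2 * pi,
      c * cos (G_angle r b phi) = h &
      c * sin (G_angle r b phi) = D * sin (phi + gamma)].
Proof.
move=> phiD; have [Dc Ds] := LG_gammaP.
set x := (1 - (1 - cos phi) * r ^+ 2) * b 0 0 + r * sin phi * b 1 0
         + (1 - cos phi) * r * c * b 2 0.
set y := - (r * sin phi) * b 0 0 + cos phi * b 1 0 + sin phi * c * b 2 0.
have N0 : cos phi * (c * (c * b 2 0 - r * b 0 0)) - sin phi * (c * b 1 0)
          = - (r * h).
  by rewrite -LG_D_delta -phiD cosD -Dc -Ds; ring.
have xE : c * x = h.
  apply/eqP; rewrite -subr_eq0; apply/eqP.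
  transitivity (r * (- (r * h) - (cos phi * (c * (c * b 2 0 - r * b 0 0))
    - sin phi * (c * b 1 0)))); last by rewrite N0; ring.
  by rewrite /x; ring: c2.
have yE : c * y = D * sin (phi + gamma).
  transitivity (sin phi * (D * cos gamma) + cos phi * (D * sin gamma)).
    by rewrite Dc Ds /y; ring.
  by rewrite sinD; ring.
have xy : x ^+ 2 + y ^+ 2 = 1.
  apply: (@mulfI _ (c ^+ 2)); first by rewrite expf_neq0 // gt_eqF.
  rewrite mulrDr -!exprMn xE yE exprMn sin2cos2 phiD mulrBr -exprMn LG_D_delta.
  by rewrite LG_D_sqr; ring: c2.
have [a aP] := unit_circle_angle_2pi xy.
rewrite /G_angle; set P := (X in get X).
by have [-> -> ->] := getPex (ex_intro P a aP).
Qed.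

Lemma LG_compare :
  LG_length r (phi1_s1 r b) (phi2_s1 r b)
    <= LG_length r (phi1_s2 r b) (phi2_s2 r b)
  /\ 0 <= phi2_s1 r b <= pi.
Proof.
have p0 : 0 < (pi : R) := pi_gt0 R.
have D0 := LG_D_gt0.
have [r0 r1] := andP r01.
set a := acos delta.
have ca : cos a = delta by apply: acosK; rewrite in_itv /= LG_delta_itv.
have a0 : 0 <= a := acos_ge0 LG_delta_itv.
have a1 : a <= pi := acos_lepi LG_delta_itv.
have sa : 0 <= sin a by apply: sin_ge0_pi; rewrite a0.
have [k1 E1] : exists k : int, phi1_s1 r b + gamma = a + k%:~R * (2 * pi).
  exists (- Num.floor ((a - gamma) / (2 * pi))).
  by rewrite mulrNz /phi1_s1 /mod2pi -/a; ring.
have [k2 E2] : exists k : int, phi1_s2 r b + gamma = - a + k%:~R * (2 * pi).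
  exists (1 - Num.floor ((2 * pi - a - gamma) / (2 * pi))).
  by rewrite intrB /phi1_s2 /mod2pi -/a; ring.
have [] := @G_angleP (phi1_s1 r b); first by rewrite E1 cosDz2pi.
rewrite E1 sinDz2pi -/(phi2_s1 r b) => /andP[f0 f1] cf sf.
have [] := @G_angleP (phi1_s2 r b); first by rewrite E2 cosDz2pi cosN.
rewrite E2 sinDz2pi sinN -/(phi2_s2 r b) => /andP[g0 g1] cg sg.
set f := phi2_s1 r b in f0 f1 cf sf *; set g := phi2_s2 r b in g0 g1 cg sg *.
have sinB2pi x : sin (2 * pi - x) = - sin x.
  by rewrite addrC -[2 * pi]mul1r (sinDz2pi _ 1) sinN.
have cosB2pi x : cos (2 * pi - x) = cos x.
  by rewrite addrC -[2 * pi]mul1r (cosDz2pi _ 1) cosN.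
have fpi : f <= pi.
  rewrite leNgt; apply/negP => pf.
  have : 0 < sin (2 * pi - f) by apply: sin_gt0_pi; apply/andP; split; lra.
  by rewrite sinB2pi oppr_gt0 -(pmulr_rlt0 _ c_gt0) sf ltNge mulr_ge0 // ltW.
split; last by rewrite f0.
rewrite /LG_length -/f -/g.
(* Here a is 0 or pi and the two paths coincide. This case is separate because g = 2 pi - f fails
   for f = g = 0. *)
have [sa0|sa0] := eqVneq (sin a) 0.
  have E : phi1_s1 r b = phi1_s2 r b.
    rewrite /phi1_s1 /phi1_s2 -/a.
    have [az|an0] := eqVneq a 0.
      by rewrite az !subr0 sub0r addrC -[2 * pi]mul1r (mod2piDz _ 1).
    have [->|anpi] := eqVneq a pi; first by congr (mod2pi (_ - _)); ring.
    by have := @sin_gt0_pi R a; rewrite sa0 ltxx !lt_neqAle a0 a1 eq_sym an0 anpi => /(_ isT).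
  by rewrite /f /g /phi2_s1 /phi2_s2 E.
have sa_gt0 : 0 < sin a by rewrite lt_neqAle eq_sym sa0.
have gpi : pi <= g.
  rewrite leNgt; apply/negP => gp.
  have : 0 <= sin g by apply: sin_ge0_pi; rewrite g0 ltW.
  by rewrite -(pmulr_rge0 _ c_gt0) sg mulrN oppr_ge0 leNgt mulr_gt0.
have gE : g = 2 * pi - f.
  suff -> : f = 2 * pi - g by ring.
  apply: cos_inj; rewrite ?in_itv /= ?f0 //; first by apply/andP; split; lra.
  by rewrite cosB2pi; apply: (mulfI (lt0r_neq0 c_gt0)); rewrite cf cg.
(* The angles before reduction differ by 2 a up to a full turn; only this direction survives a
   wrap-around. *)
have phi1_le : phi1_s1 r b <= phi1_s2 r b + 2 * a.
  have -> : phi1_s1 r b = mod2pi (2 * pi - a - gamma + 2 * a).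
    rewrite /phi1_s1 -/a -[LHS](mod2piDz _ 1); congr mod2pi; ring.
  by apply: mod2piD_le; rewrite mulr_ge0.
(* D (cos a, sin a) = c (r cos (pi - f), sin (pi - f)), so [sin_scale_le]
   decides the sign of sin (r a - (pi - f)). *)
have ra_le : r * a - (pi - f) <= 0.
  (* The lower bound is strict because 2 pi - f = g < 2 pi gives f > 0. *)
  apply: sin_le0_le0; first by apply/andP; split; nra.
  rewrite opprB addrA sinB sinpi cospi mulr0 subr0 mulrN1 oppr_le0 sinD addrC.
  rewrite -(pmulr_rge0 _ (mulr_gt0 c_gt0 r0)).
  have -> : c * r * (cos (r * a) * sin f + sin (r * a) * cos f) =
      D * (r * (sin a * cos (r * a)) - cos a * sin (r * a)).
    transitivity (r * cos (r * a) * (c * sin f) + r * sin (r * a) * (c * cos f)).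
      by ring.
    rewrite sf cf ca mulrBr [D * (delta * _)]mulrA LG_D_delta; ring.
  rewrite pmulr_rge0 // subr_ge0; apply: sin_scale_le; last by rewrite a0.
  by rewrite !ltW.
(* Compared with the second path, the first loses at most 2 r a on the L arc and gains g - f = 2 (pi
   - f) on the G arc. *)
have := ler_wpM2l (ltW r0) phi1_le.
rewrite gE; lra.
Qed.

End Angles.

Theorem lemma14 (R : realType) (r : R) (hr : 0 < r < 1)
    (g0 : 'M[R]_3) (hg0 : SO3 g0)
    (Xf : 'cV[R]_3) (hXf : on_sphere Xf)
    (hLG : LG_path_exists r g0 Xf) :
  let beta := local_coords g0 Xf in
  LG_length r (phi1_s1 r beta) (phi2_s1 r beta)
    <= LG_length r (phi1_s2 r beta) (phi2_s2 r beta)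
  /\ 0 <= phi2_s1 r beta <= pi.
Proof.
move=> beta; apply: LG_compare => //; first exact: local_coords_norm.
exact: LG_path_axis_bound.
Qed.
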